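(* Let $X$ be a real Banach space and let $f:\mathbb{R}\to X$ be an arbitrary mapping. Then the set of points $x\in\mathbb{R}$ where either $mD_-(f,x)>mD^+(f,x)$ or $mD_+(f,x)>mD^-(f,x)$ is countable.
   Context: For $f:\mathbb{R}\to X$ and $x\in\mathbb{R}$, the unilateral upper and lower metric derived numbers are $mD^{\pm}(f,x)=\limsup_{t\to0+}\frac{\|f(x\pm t)-f(x)\|}{t}$ and $mD_{\pm}(f,x)=\liminf_{t\to0+}\frac{\|f(x\pm t)-f(x)\|}{t}$, with values in $[0,+\infty]$ (the value $+\infty$ is allowed). ''Countable'' means finite or countably infinite. *)

(* Defs.v *)
From mathcomp Require Import all_boot all_order all_algebra.
From mathcomp Require Import all_classical all_reals all_analysis.

Set Implicit Arguments.
Unset Strict Implicit.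
Unset Printing Implicit Defensive.

Import Order.TTheory GRing.Theory Num.Theory.
Import numFieldNormedType.Exports.

Local Open Scope classical_set_scope.
Local Open Scope ring_scope.

Section metric_derived_numbers.
Context {R : realType} {X : normedModType R}.
Implicit Types (f : R -> X) (x : R).

(* In the names, upper/lower stands for limsup/liminf (the position of the
   sign in mD^± / mD_±) and right/left for the sign + / -. *)

Definition mD_upper_right f x : \bar R :=
  limf_esup (fun t : R => (`|f (x + t) - f x| / t)%:E) (0 : R)^'+.

Definition mD_upper_left f x : \bar R :=
  limf_esup (fun t : R => (`|f (x - t) - f x| / t)%:E) (0 : R)^'+.

Definition mD_lower_right f x : \bar R :=
  limf_einf (fun t : R => (`|f (x + t) - f x| / t)%:E) (0 : R)^'+.

Definition mD_lower_left f x : \bar R :=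
  limf_einf (fun t : R => (`|f (x - t) - f x| / t)%:E) (0 : R)^'+.

End metric_derived_numbers.

(* Main.v *)
(* If [mD^+(f,x) < q < mD_-(f,x)] with [q] rational, then for some [n] and all
   [0 < t < 1/n] the difference quotients of [f] at [x] with steps [t] and [-t]
   are respectively below and above [q].  Two points [x < y] sharing the same [q]
   and [n] cannot be closer than [1/n]: the quotient of [x] and [y] would be both
   below [q] (seen from [x]) and above [q] (seen from [y]).  Hence the set is a
   countable union of uniformly separated, thus countable, sets.  The other
   inequality only exchanges the two directions. *)
Require Import Defs.
From mathcomp Require Import all_boot all_order all_algebra.
From mathcomp Require Import all_classical all_reals all_analysis.

Import Order.TTheory GRing.Theory Num.Theory.
Import numFieldNormedType.Exports.

Local Open Scope classical_set_scope.
Local Open Scope ring_scope.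

Lemma lte_rat_between (R : realType) (a b : \bar R) :
  (a < b)%E -> exists q : rat, (a < (ratr q)%:E < b)%E.
Proof.
have real_between (x y : R) (xy : x < y) : exists q : rat, x < ratr q < y.
  by have [q] := rat_in_itvoo xy; rewrite in_itv /=; exists q.
case: a b => [x| |] [y| |] //= ab.
- by have [q xqy] := real_between _ _ ab; exists q; rewrite !lte_fin.
- have [|q /andP[xq _]] := real_between x (x + 1); first by rewrite ltrDl.
  by exists q; rewrite lte_fin xq ltry.
- have [|q /andP[_ qy]] := real_between (y - 1) y; first by rewrite gtrBl.
  by exists q; rewrite lte_fin qy ltNyr.
- by exists 0; rewrite ltNyr ltry.
Qed.

(** The upper limit is an infimum of suprema over the members of [F], so some member already has its
    supremum below [a]. *)
Lemma limf_esup_lt_near (T : choiceType) (X : filteredType T) (R : realType)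
    (f : X -> \bar R) (F : set_system X) (a : \bar R) : Filter F ->
  (limf_esup f F < a)%E -> \forall x \near F, (f x < a)%E.
Proof.
move=> FF /ereal_inf_lt[_ [V FV <-] supVa]; apply: filterS FV => x Vx.
by apply: le_lt_trans supVa; apply: ereal_sup_ubound; exists x.
Qed.

Lemma limf_einf_gt_near (T : choiceType) (X : filteredType T) (R : realType)
    (f : X -> \bar R) (F : set_system X) (a : \bar R) : Filter F ->
  (a < limf_einf f F)%E -> \forall x \near F, (a < f x)%E.
Proof.
rewrite limf_einfE.
move=> FF /ereal_sup_gt[_ [V FV <-] ainfV]; apply: filterS FV => x Vx.
by apply: (lt_le_trans ainfV); apply: ereal_inf_lbound; exists x.
Qed.

Lemma near_at_right0_natSinv (R : realType) (P : set R) :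
  (\forall t \near 0^'+, P t) ->
  exists n : nat, forall t, 0 < t -> t < n.+1%:R^-1 -> P t.
Proof.
move=> [e /= e0 eP].
have [n] := ltr_add_invr e0; rewrite add0r => ne.
exists n => t t0 tn; apply: eP => //=.
by rewrite sub0r normrN gtr0_norm// (lt_trans tn).
Qed.

(** The map sending [x] to the floor of [x / e] is injective on [A]: two points with the same floor
    are less than [e] apart. *)
Lemma countable_separated (R : realType) (A : set R) (e : R) : 0 < e ->
  (forall x y, A x -> A y -> x < y -> e <= y - x) -> countable A.
Proof.
move=> e0 Asep; apply/countable_injP.
exists (fun x => pickle (Num.floor (x / e))) => x y /set_mem Ax /set_mem Ay.
move=> /(pcan_inj pickleK) xy.
wlog ltxy : x y Ax Ay xy / x < y.
  move=> W; have [ltxy|ltyx|//] := ltgtP x y; first exact: W.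
  by apply/esym/W.
have := Asep x y Ax Ay ltxy; rewrite leNgt => /negP[].
have /andP[xl _] := floor_itv (x / e); have /andP[_] := floor_itv (y / e).
rewrite -xy intrD => yl.
rewrite -(ltr_pM2r (x := e^-1)) ?invr_gt0// divff ?gt_eqF// mulrBl ltrBlDl.
by apply: lt_le_trans yl _; rewrite lerD2r.
Qed.

Theorem theorem3p2 (R : realType) (X : completeNormedModType R) (f : R -> X) :
  countable [set x : R |
    (mD_lower_left f x > mD_upper_right f x)%E \/
    (mD_lower_right f x > mD_upper_left f x)%E].
Proof.
(* The flag [b] gives the direction of the step, [true] for right, so that both inequalities are
   treated at once. *)
pose quot (b : bool) x t := `|f (if b then x + t else x - t) - f x| / t.
(* The chord between [x] and [y] has the same quotient seen from either endpoint, in opposite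
   directions. *)
have quotC b x y :
    quot b (if b then x else y) (y - x) = quot (~~ b) (if b then y else x) (y - x).
  by case: b; rewrite /quot /= subKr subrKC distrC.
pose E (p : bool * rat * nat) := let: (b, q, n) := p in
  [set x | forall t, 0 < t -> t < n.+1%:R^-1 ->
    quot b x t < ratr q /\ ratr q < quot (~~ b) x t].
have EP b x : (limf_esup (fun t => (quot b x t)%:E) 0^'+ <
    limf_einf (fun t => (quot (~~ b) x t)%:E) 0^'+)%E -> (\bigcup_p E p) x.
  move=> /(lte_rat_between _ _ _)[q /andP[/limf_esup_lt_near bq /limf_einf_gt_near qb]].
  have [n nE] := near_at_right0_natSinv _ _ (filterI bq qb).
  by exists (b, q, n) => // t t0 tn; have [] := nE t t0 tn; rewrite !lte_fin.
apply: (@sub_countable _ _ _ (\bigcup_p E p)).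
  by apply: subset_card_le => x [/(EP true)|/(EP false)].
apply: bigcup_countable => // -[[b q] n] _.
apply: (@countable_separated _ _ n.+1%:R^-1) => [|x y Ex Ey xy].
  by rewrite invr_gt0.
rewrite leNgt; apply/negP => yx.
have yx0 : 0 < y - x by rewrite subr_gt0.
have [xq qx] := Ex _ yx0 yx; have [yq qy] := Ey _ yx0 yx.
(* The common quotient is below [q] at one endpoint and above [q] at the other; [b] decides which is
   which. *)
case: b {Ex Ey} (quotC b x y) xq qx yq qy => /= eq_q xq qx yq qy.
- by move: qy; rewrite -eq_q ltNge ltW.
- by move: qx; rewrite -eq_q ltNge ltW.
Qed.
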